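(* For any simplicially enriched category $\mathcal{S}$ and any commutative unital ring $R$, the path algebra $R[\mathcal{S}]$ is $s$-unital on both sides as an $R[\mathcal{S}]$-bimodule: for every $x\in R[\mathcal{S}]$ there exist $e,e'\in R[\mathcal{S}]$ with $e\times x=x$ and $x\times e'=x$ (and thus $R[\mathcal{S}]$ is idempotent, i.e. $R[\mathcal{S}]^2=R[\mathcal{S}]$).
   Context: A simplicially enriched category $\mathcal{S}$ (with a set of objects) is a category enriched over simplicial sets: for objects $A,B$ there is a simplicial set $\mathcal{S}(A,B)$, and composition $\mathcal{S}(A,B)\times\mathcal{S}(B,C)\to\mathcal{S}(A,C)$, $(f,g)\mapsto g\circ f$, is a simplicial map. Its category of $1$-morphisms $\mathcal{S}_0$ has the same objects, morphisms $\mathcal{S}_0(A,B)=(\mathcal{S}(A,B))_0$ (the $0$-simplices), and composition $\circ_0$ the restriction of $\circ$ to $0$-simplices. The path algebra $R[\mathcal{S}]$ is the free left $R$-module on the set of all morphisms of $\mathcal{S}_0$, with the $R$-bilinear product determined, for morphisms $f:X\to Y$ and $g:Z\to T$ of $\mathcal{S}_0$, by $g\times f=g\circ_0 f$ if $Z=Y$ and $g\times f=0$ otherwise. It is an $R$-algebra, in general without unit. *)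

(* Defs.v *)
From HB Require Import structures.
From mathcomp Require Import all_boot all_order all_algebra.
From mathcomp Require Import finmap.
From mathcomp Require Import boolp classical_sets.
From mathcomp Require Import monalg.

Set Implicit Arguments.
Unset Strict Implicit.
Unset Printing Implicit Defensive.

Import Order.TTheory GRing.Theory.

Local Open Scope ring_scope.

(* The simplex category has the objects 'I_n.+1 = {0 < ... < n} and the        *)
(* nondecreasing maps, the order being the canonical one on ordinals.          *)
Record simplicial_set := SimplicialSet {
  simplex :> nat -> Type;
  sset_map : forall m n : nat,
    {omorphism 'I_m.+1 -> 'I_n.+1} -> simplex n -> simplex m;
  sset_map_id : forall (n : nat) (x : simplex n), sset_map idfun x = x;
  sset_map_comp : forall (m n p : nat) (f : {omorphism 'I_n.+1 -> 'I_p.+1})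
      (g : {omorphism 'I_m.+1 -> 'I_n.+1}) (x : simplex p),
    sset_map (f \o g) x = sset_map g (sset_map f x) }.

Record simplicial_map (X Y : simplicial_set) := SimplicialMap {
  smap :> forall n : nat, X n -> Y n;
  smap_natural : forall (m n : nat) (f : {omorphism 'I_m.+1 -> 'I_n.+1})
      (x : X n),
    smap (sset_map f x) = sset_map f (smap x) }.

Definition sset_prod (X Y : simplicial_set) : simplicial_set.
Proof.
refine (@SimplicialSet (fun n => (X n * Y n)%type)
  (fun m n f xy => (sset_map f xy.1, sset_map f xy.2)) _ _).
- by move=> n [x y]; rewrite !sset_map_id.
- by move=> m n p f g [x y]; rewrite !sset_map_comp.
Defined.

Definition sset_point : simplicial_set :=
  @SimplicialSet (fun=> unit) (fun m n f x => x)
    (fun n x => erefl) (fun m n p f g x => erefl).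

(* Composition takes its arguments in diagrammatic order: [scomp A B C] sends *)
(* (f, g) to g after f.                                                         *)
Record simplicial_category := SimplicialCategory {
  sobj :> Type;
  shom : sobj -> sobj -> simplicial_set;
  scomp : forall A B C : sobj,
    simplicial_map (sset_prod (shom A B) (shom B C)) (shom A C);
  sunit : forall A : sobj, simplicial_map sset_point (shom A A);
  scompA : forall (A B C D : sobj) (n : nat)
      (f : shom A B n) (g : shom B C n) (h : shom C D n),
    scomp A C D n (scomp A B C n (f, g), h) =
    scomp A B D n (f, scomp B C D n (g, h));
  scomp_unitl : forall (A B : sobj) (n : nat) (f : shom A B n),
    scomp A A B n (sunit A n tt, f) = f;
  scomp_unitr : forall (A B : sobj) (n : nat) (f : shom A B n),
    scomp A B B n (f, sunit B n tt) = f }.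

(* [ccomp g f] is g after f. *)
Record category := Category {
  cobj :> Type;
  chom : cobj -> cobj -> Type;
  cid : forall A : cobj, chom A A;
  ccomp : forall A B C : cobj, chom B C -> chom A B -> chom A C;
  ccompA : forall (A B C D : cobj)
      (h : chom C D) (g : chom B C) (f : chom A B),
    ccomp h (ccomp g f) = ccomp (ccomp h g) f;
  ccomp_idr : forall (A B : cobj) (f : chom A B), ccomp f (cid A) = f;
  ccomp_idl : forall (A B : cobj) (f : chom A B), ccomp (cid B) f = f }.

Definition one_morphisms (S : simplicial_category) : category.
Proof.
refine (@Category (sobj S) (fun A B => shom A B 0%N)
  (fun A => sunit A 0%N tt) (fun A B C g f => scomp A B C 0%N (f, g)) _ _ _).
- by move=> A B C D h g f; rewrite scompA.
- by move=> A B f; apply: scomp_unitl.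
- by move=> A B f; apply: scomp_unitr.
Defined.

Record nu_algebra (R : comPzRingType) := NUAlgebra {
  nu_sort :> lmodType R;
  nu_mul : nu_sort -> nu_sort -> nu_sort;
  nu_mulA : associative nu_mul;
  nu_mulDl : left_distributive nu_mul +%R;
  nu_mulDr : right_distributive nu_mul +%R;
  nu_scaleAl : forall (a : R) (x y : nu_sort),
    a *: nu_mul x y = nu_mul (a *: x) y;
  nu_scaleAr : forall (a : R) (x y : nu_sort),
    a *: nu_mul x y = nu_mul x (a *: y) }.

Record nu_bimodule (R : comPzRingType) (A : nu_algebra R) := NUBimodule {
  bim_sort :> lmodType R;
  lact : A -> bim_sort -> bim_sort;
  ract : bim_sort -> A -> bim_sort;
  lactA : forall (a b : A) (m : bim_sort),
    lact (nu_mul a b) m = lact a (lact b m);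
  ractA : forall (m : bim_sort) (a b : A),
    ract m (nu_mul a b) = ract (ract m a) b;
  lractA : forall (a : A) (m : bim_sort) (b : A),
    ract (lact a m) b = lact a (ract m b);
  lactDl : forall (a b : A) (m : bim_sort),
    lact (a + b) m = lact a m + lact b m;
  lactDr : forall (a : A) (m n : bim_sort),
    lact a (m + n) = lact a m + lact a n;
  ractDl : forall (m n : bim_sort) (a : A),
    ract (m + n) a = ract m a + ract n a;
  ractDr : forall (m : bim_sort) (a b : A),
    ract m (a + b) = ract m a + ract m b;
  lact_scalel : forall (c : R) (a : A) (m : bim_sort),
    c *: lact a m = lact (c *: a) m;
  lact_scaler : forall (c : R) (a : A) (m : bim_sort),
    c *: lact a m = lact a (c *: m);
  ract_scalel : forall (c : R) (m : bim_sort) (a : A),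
    c *: ract m a = ract (c *: m) a;
  ract_scaler : forall (c : R) (m : bim_sort) (a : A),
    c *: ract m a = ract m (c *: a) }.

Definition regular_bimodule (R : comPzRingType) (A : nu_algebra R) :
    nu_bimodule A :=
  @NUBimodule R A (nu_sort A) (@nu_mul R A) (@nu_mul R A)
    (fun a b m => esym (nu_mulA a b m)) (@nu_mulA R A)
    (fun a m b => esym (nu_mulA a m b))
    (@nu_mulDl R A) (fun a m n => nu_mulDr a m n)
    (@nu_mulDl R A) (fun m a b => nu_mulDr m a b)
    (@nu_scaleAl R A) (@nu_scaleAr R A) (@nu_scaleAl R A) (@nu_scaleAr R A).

Definition s_unital (R : comPzRingType) (A : nu_algebra R)
    (M : nu_bimodule A) : Prop :=
  forall m : M, exists e e' : A, lact e m = m /\ ract m e' = m.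

(* The submodule A^2 spanned by the products. Scalars are absorbed into a      *)
(* factor, so finite sums of products suffice.                                *)
Definition nu_square (R : comPzRingType) (A : nu_algebra R) : set A :=
  [set x | exists s : seq (A * A), x = \sum_(p <- s) nu_mul p.1 p.2]%classic.
Arguments nu_square {R} A _.

Definition nu_idempotent (R : comPzRingType) (A : nu_algebra R) : Prop :=
  nu_square A = [set: A]%classic.

Record arrow (C : category) := Arrow {
  adom : C;
  acod : C;
  ahom : chom adom acod }.

(* Finitely supported functions on the arrows. [malg] carries a module        *)
(* structure only over nontrivial rings, hence the separate name, which is    *)
(* given one over every ring below.                                           *)
Definition path_module (R : comPzRingType) (C : category) : Type :=
  {malg R[{classic arrow C}]}.

Section PathModule.
Variables (R : comPzRingType) (C : category).
Local Notation V := (path_module R C).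

HB.instance Definition _ := GRing.Zmodule.copy V {malg R[{classic arrow C}]}.

Definition path_scale (c : R) (x : V) : V :=
  [malg k in msupp (x : {malg R[{classic arrow C}]}) => c * mcoeff k x].

Definition path_coeff (k : arrow C) (x : V) : R := mcoeff (k : {classic arrow C}) x.

Lemma path_scaleE (c : R) (x : V) (k : arrow C) :
  path_coeff k (path_scale c x) = c * path_coeff k x.
Proof.
by rewrite /path_coeff /path_scale mcoeffE; case: msuppP; rewrite ?mulr0.
Qed.

Lemma path_coeffD (k : arrow C) (x y : V) :
  path_coeff k (x + y) = path_coeff k x + path_coeff k y.
Proof. exact: (mcoeffD (k : {classic arrow C})). Qed.

Lemma path_moduleP (x y : V) :
  (forall k, path_coeff k x = path_coeff k y) -> x = y.
Proof. by move=> h; apply/malgP. Qed.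

Fact path_scaleA a b (x : V) :
  path_scale a (path_scale b x) = path_scale (a * b) x.
Proof. by apply: path_moduleP => k; rewrite !path_scaleE mulrA. Qed.

Fact path_scale1 : left_id 1 path_scale.
Proof. by move=> x; apply: path_moduleP => k; rewrite path_scaleE mul1r. Qed.

Fact path_scaleDr : right_distributive path_scale +%R.
Proof.
move=> a x y; apply: path_moduleP => k.
by rewrite path_coeffD !path_scaleE path_coeffD mulrDr.
Qed.

Fact path_scaleDl (x : V) : {morph path_scale^~ x : a b / a + b}.
Proof.
move=> a b; apply: path_moduleP => k.
by rewrite path_coeffD !path_scaleE mulrDl.
Qed.

HB.instance Definition _ := GRing.Zmodule_isLmodule.Build R V
  path_scaleA path_scale1 path_scaleDr path_scaleDl.

Definition path_basis (f : arrow C) : V := mkmalgU (f : {classic arrow C}) 1.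

Definition arrow_mul (g f : arrow C) : V :=
  match pselect (acod f = adom g) with
  | left e => path_basis
      (Arrow (ccomp (ahom g) (eq_rect (acod f) (chom (adom f)) (ahom f) _ e)))
  | right _ => 0
  end.

Definition path_mul (x y : V) : V :=
  \sum_(g <- msupp (x : {malg R[{classic arrow C}]}))
    \sum_(f <- msupp (y : {malg R[{classic arrow C}]}))
      (path_coeff g x * path_coeff f y) *: arrow_mul g f.

Lemma arrow_mul_comp (A B D : C) (g : chom B D) (f : chom A B) :
  arrow_mul (Arrow g) (Arrow f) = path_basis (Arrow (ccomp g f)).
Proof.
rewrite /arrow_mul /=; case: pselect => [e|//].
by rewrite (Prop_irrelevance e erefl).
Qed.

Lemma arrow_mul_neq (g f : arrow C) :
  acod f <> adom g -> arrow_mul g f = 0.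
Proof. by rewrite /arrow_mul; case: pselect. Qed.

Definition path_lift (F : arrow C -> V) (x : V) : V :=
  \sum_(k <- msupp (x : {malg R[{classic arrow C}]})) path_coeff k x *: F k.

Lemma path_liftw (F : arrow C -> V) (x : V) (d : {fset {classic arrow C}}) :
  (msupp (x : {malg R[{classic arrow C}]}) `<=` d)%fset ->
  path_lift F x = \sum_(k <- d) path_coeff k x *: F k.
Proof.
move=> le_d; rewrite /path_lift (big_fset_incl _ le_d) // => k _ /mcoeff_outdom.
by rewrite /path_coeff => ->; rewrite scale0r.
Qed.

Lemma path_liftD F x y : path_lift F (x + y) = path_lift F x + path_lift F y.
Proof.
pose d := (msupp (x : {malg R[{classic arrow C}]}) `|`
  msupp (y : {malg R[{classic arrow C}]}))%fset.
rewrite (path_liftw F (fsubsetUl _ _ : (_ `<=` d)%fset)).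
rewrite (path_liftw F (fsubsetUr _ _ : (_ `<=` d)%fset)) (path_liftw F (msuppD_le _ _)).
rewrite -big_split /=; apply: eq_bigr => k _.
by rewrite path_coeffD scalerDl.
Qed.

Lemma path_liftZ F a x : path_lift F (a *: x) = a *: path_lift F x.
Proof.
have le_x : (msupp (a *: x : {malg R[{classic arrow C}]}) `<=`
    msupp (x : {malg R[{classic arrow C}]}))%fset.
  apply/fsubsetP => k; rewrite -!mcoeff_neq0; apply: contra_neq => xk.
  by have := path_scaleE a x k; rewrite /path_coeff xk mulr0.
rewrite (path_liftw F le_x) /path_lift scaler_sumr; apply: eq_bigr => k _.
by rewrite scalerA -path_scaleE.
Qed.

Lemma path_lift0 F : path_lift F 0 = 0.
Proof. by have := path_liftZ F 0 0; rewrite !scale0r. Qed.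

Lemma path_lift_basis F f : path_lift F (path_basis f) = F f.
Proof.
have le_f : (msupp (path_basis f : {malg R[{classic arrow C}]}) `<=`
    [fset (f : {classic arrow C})])%fset by exact: msuppU_le.
by rewrite (path_liftw F le_f) big_seq_fset1 /path_coeff mcoeffUU scale1r.
Qed.

Lemma eq_path_lift F G x : (forall k, F k = G k) -> path_lift F x = path_lift G x.
Proof. by move=> e; apply: eq_bigr => k _; rewrite e. Qed.

Lemma path_lift_lin (L : V -> V) F x : (forall u v, L (u + v) = L u + L v) ->
  (forall a u, L (a *: u) = a *: L u) ->
  L (path_lift F x) = path_lift (fun k => L (F k)) x.
Proof.
move=> LD LZ; have L0 : L 0 = 0 by have := LZ 0 0; rewrite !scale0r.
rewrite /path_lift (big_morph L LD L0); apply: eq_bigr => k _; exact: LZ.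
Qed.

Lemma path_mulE x y : path_mul x y = path_lift (fun g => path_lift (arrow_mul g) y) x.
Proof.
apply: eq_bigr => g _; rewrite /path_lift scaler_sumr.
by apply: eq_bigr => f _; rewrite scalerA.
Qed.

Lemma path_lift_funD (F G : arrow C -> V) x :
  path_lift (fun k => F k + G k) x = path_lift F x + path_lift G x.
Proof.
by rewrite /path_lift -big_split /=; apply: eq_bigr => k _; rewrite scalerDr.
Qed.

Lemma path_lift_funZ (F : arrow C -> V) a x :
  path_lift (fun k => a *: F k) x = a *: path_lift F x.
Proof.
rewrite /path_lift scaler_sumr; apply: eq_bigr => k _.
by rewrite !scalerA mulrC.
Qed.

Lemma path_mulDl : left_distributive path_mul +%R.
Proof. by move=> x y z; rewrite !path_mulE path_liftD. Qed.

Lemma path_mulDr : right_distributive path_mul +%R.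
Proof.
move=> x y z; rewrite !path_mulE -path_lift_funD; apply: eq_path_lift => k.
exact: path_liftD.
Qed.

Lemma path_scaleAl a (x y : V) : a *: path_mul x y = path_mul (a *: x) y.
Proof. by rewrite !path_mulE path_liftZ. Qed.

Lemma path_scaleAr a (x y : V) : a *: path_mul x y = path_mul x (a *: y).
Proof.
by rewrite !path_mulE -path_lift_funZ; apply: eq_path_lift => k; rewrite path_liftZ.
Qed.

Lemma path_mul_basis (g f : arrow C) :
  path_mul (path_basis g) (path_basis f) = arrow_mul g f.
Proof. by rewrite path_mulE !path_lift_basis. Qed.

Lemma arrow_mulA (h g f : arrow C) :
  path_mul (path_basis h) (arrow_mul g f) =
  path_mul (arrow_mul h g) (path_basis f).
Proof.
have mul0 x : path_mul 0 x = 0 by rewrite path_mulE path_lift0.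
have mulx0 x : path_mul x 0 = 0.
  by have := path_scaleAr 0 x 0; rewrite !scale0r.
have [e1|n1] := pselect (acod f = adom g); last first.
  rewrite (arrow_mul_neq n1) mulx0.
  have [e2|n2] := pselect (acod g = adom h).
    case: g h e2 n1 => [A B g] [B' D h] /= e2 n1; subst B'.
    by rewrite arrow_mul_comp path_mul_basis arrow_mul_neq.
  by rewrite (arrow_mul_neq n2) mul0.
case: f g e1 => [A B f] [B' D g] /= e1; subst B'.
rewrite arrow_mul_comp path_mul_basis.
have [e2|n2] := pselect (D = adom h).
  case: h e2 => [D' E h] /= e2; subst D'.
  by rewrite !arrow_mul_comp path_mul_basis arrow_mul_comp ccompA.
by rewrite !arrow_mul_neq ?mul0.
Qed.

Lemma path_mulA : associative path_mul.
Proof.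
move=> x y z.
have lift_id (u : V) : u = path_lift (@path_basis) u.
  rewrite [LHS]monalgE; apply: eq_bigr => k _; apply: path_moduleP => j.
  by rewrite path_scaleE /path_coeff !mcoeffU mulrnAr mulr1.
rewrite [x]lift_id.
rewrite (path_lift_lin (L := fun x => path_mul x (path_mul y z))); first last.
- by move=> a u; rewrite path_scaleAl.
- by move=> u v; rewrite path_mulDl.
rewrite (path_lift_lin (L := fun x => path_mul (path_mul x y) z)); first last.
- by move=> a u; rewrite !path_scaleAl.
- by move=> u v; rewrite !path_mulDl.
apply: eq_path_lift => h; rewrite [y]lift_id.
rewrite (path_lift_lin (L := fun y => path_mul (path_basis h) (path_mul y z))); first last.
- by move=> a u; rewrite path_scaleAr path_scaleAl.
- by move=> u v; rewrite path_mulDl path_mulDr.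
rewrite (path_lift_lin (L := fun y => path_mul (path_mul (path_basis h) y) z)); first last.
- by move=> a u; rewrite path_scaleAl path_scaleAr.
- by move=> u v; rewrite path_mulDr path_mulDl.
apply: eq_path_lift => g; rewrite [z]lift_id.
rewrite (path_lift_lin (L := fun z => path_mul (path_basis h) (path_mul (path_basis g) z))); first last.
- by move=> a u; rewrite !path_scaleAr.
- by move=> u v; rewrite !path_mulDr.
rewrite (path_lift_lin (L := fun z => path_mul (path_mul (path_basis h) (path_basis g)) z)); first last.
- by move=> a u; rewrite !path_scaleAr.
- by move=> u v; rewrite !path_mulDr.
by apply: eq_path_lift => f; rewrite !path_mul_basis arrow_mulA.
Qed.

End PathModule.

Definition path_algebra (R : comPzRingType) (S : simplicial_category) :
    nu_algebra R :=
  @NUAlgebra R (path_module R (one_morphisms S))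
    (@path_mul R (one_morphisms S)) (@path_mulA R (one_morphisms S))
    (@path_mulDl R (one_morphisms S)) (@path_mulDr R (one_morphisms S))
    (@path_scaleAl R (one_morphisms S)) (@path_scaleAr R (one_morphisms S)).

(* Main.v *)
Require Import Defs.
From mathcomp Require Import all_boot all_order all_algebra.
From mathcomp Require Import finmap boolp classical_sets monalg.

Set Implicit Arguments.
Unset Strict Implicit.
Unset Printing Implicit Defensive.

Import GRing.Theory.

Local Open Scope ring_scope.

(** An element of the path algebra involves finitely many arrows, hence finitely
    many sources and targets. The sum of the identities of its targets is a left
    unit for it and the sum of the identities of its sources is a right unit;
    each object must be counted once, so the sums range over finite sets. *)

Section LocalUnits.
Variables (R : comPzRingType) (C : category).
Local Notation V := (path_module R C).

(** The type [{classic C}] equips the bare type of objects with a classical decidable equality, as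
    finite sets require. *)
Definition local_unit (D : {fset {classic C}}) : V :=
  \sum_(A <- D) path_basis R (Arrow (Defs.cid (A : C))).

(** Reduces identities linear in [x] to basis arrows. *)
Lemma path_basis_span (x : V) : path_lift (@path_basis R C) x = x.
Proof.
rewrite [RHS]monalgE; apply: eq_bigr => k _; apply: path_moduleP => j.
by rewrite path_scaleE /path_coeff !mcoeffU mulrnAr mulr1.
Qed.

Lemma path_mul_suml (I : Type) (r : seq I) (F : I -> V) (y : V) :
  path_mul (\sum_(i <- r) F i) y = \sum_(i <- r) path_mul (F i) y.
Proof.
apply: (big_morph (fun x => path_mul x y)) => [u v|]; first exact: path_mulDl.
by rewrite path_mulE path_lift0.
Qed.

Lemma path_mul_sumr (I : Type) (r : seq I) (F : I -> V) (x : V) :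
  path_mul x (\sum_(i <- r) F i) = \sum_(i <- r) path_mul x (F i).
Proof.
apply: (big_morph (path_mul x)) => [u v|]; first exact: path_mulDr.
by have := path_scaleAr 0 x 0; rewrite !scale0r.
Qed.

(** Only the identity of the target of [f] can be composed after [f]; every other summand
    contributes a zero product. *)
Lemma local_unit_mul_basis (D : {fset {classic C}}) (f : arrow C) :
  (acod f : {classic C}) \in D ->
  path_mul (local_unit D) (path_basis R f) = path_basis R f.
Proof.
case: f => A B f /= DB; rewrite path_mul_suml (big_rem _ DB) /=.
rewrite path_mul_basis arrow_mul_comp ccomp_idl big_seq big1 ?addr0 // => B'.
(* [D] has no repetitions, so once [B] is removed every remaining [B'] differs from [B]. *)
rewrite (mem_rem_uniq _ (fset_uniq D)) => /andP[/eqP neB _].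
by rewrite path_mul_basis arrow_mul_neq //= => eqB; apply: neB.
Qed.

Lemma basis_mul_local_unit (D : {fset {classic C}}) (f : arrow C) :
  (adom f : {classic C}) \in D ->
  path_mul (path_basis R f) (local_unit D) = path_basis R f.
Proof.
case: f => A B f /= DA; rewrite path_mul_sumr (big_rem _ DA) /=.
rewrite path_mul_basis arrow_mul_comp ccomp_idr big_seq big1 ?addr0 // => A'.
rewrite (mem_rem_uniq _ (fset_uniq D)) => /andP[/eqP neA _].
by rewrite path_mul_basis arrow_mul_neq.
Qed.

Definition path_targets (x : V) : {fset {classic C}} :=
  ((fun f : {classic arrow C} => acod (f : arrow C) : {classic C})
     @` msupp (x : {malg R[{classic arrow C}]}))%fset.

Definition path_sources (x : V) : {fset {classic C}} :=
  ((fun f : {classic arrow C} => adom (f : arrow C) : {classic C})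
     @` msupp (x : {malg R[{classic arrow C}]}))%fset.

Lemma local_unit_targets (x : V) :
  path_mul (local_unit (path_targets x)) x = x.
Proof.
(* The [x] inside [path_targets x] is left unexpanded: every arrow of the support then has its
   target in that fixed set. *)
rewrite -[in X in path_mul _ X](path_basis_span x) -[RHS]path_basis_span.
rewrite path_mul_sumr; apply: eq_big_seq => f xf.
by rewrite -path_scaleAr local_unit_mul_basis //; apply/imfsetP; exists f.
Qed.

Lemma local_unit_sources (x : V) :
  path_mul x (local_unit (path_sources x)) = x.
Proof.
rewrite -[in X in path_mul X _](path_basis_span x) -[RHS]path_basis_span.
rewrite path_mul_suml; apply: eq_big_seq => f xf.
by rewrite -path_scaleAl basis_mul_local_unit //; apply/imfsetP; exists f.
Qed.

End LocalUnits.

(** A left unit [e] for [x] exhibits [x] as the single product of [e] and [x]. *)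
Lemma s_unital_idempotent (R : comPzRingType) (A : nu_algebra R) :
  s_unital (regular_bimodule A) -> nu_idempotent A.
Proof.
move=> sA; apply/seteqP; split=> // x _.
by have [e [_ [ex _]]] := sA x; exists [:: (e, x)]; rewrite big_seq1.
Qed.

Theorem proposition13 (R : comPzRingType) (S : simplicial_category) :
  s_unital (regular_bimodule (path_algebra R S)) /\
  nu_idempotent (path_algebra R S).
Proof.
have sR : s_unital (regular_bimodule (path_algebra R S)).
  move=> x; exists (local_unit R (path_targets x)).
  exists (local_unit R (path_sources x)).
  by split; [apply: local_unit_targets | apply: local_unit_sources].
by split=> //; apply: s_unital_idempotent.
Qed.
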